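(* Let $\sigma$ be a real $d\times d$ matrix and let $b(x)=\alpha+Cx$ for $x\in\mathbb{R}^d$, where $\alpha\in\mathbb{R}^d$ and $C$ is a real $d\times d$ matrix. Let $\{X(t,0)\}_{t\ge0}$ denote the solution of $dX_t=\sigma\,dB_t+b(X_t)\,dt$ with initial condition $X_0=0$. Then, almost surely (with one null set serving for all $t$ and $x$ simultaneously), for all $t\ge0$ and $x\in\mathbb{R}^d$, $$X(t,0)+e^{tC}x=x+\int_0^t\sigma\,dB_s+\alpha t+\int_0^t C\big(X(s,0)+e^{sC}x\big)\,ds,$$ so that for every $x\in\mathbb{R}^d$ the process $\{X(t,0)+e^{tC}x\}_{t\ge0}$ solves $$dX_t=\sigma\,dB_t+b(X_t)\,dt,\qquad X_0=x.$$
   Context: $(\Omega,\mathcal{F},(\mathcal{F}_t),P)$ is a filtered complete probability space satisfying the usual conditions, and $\{B_t\}$ is a standard $d$-dimensional $(\mathcal{F}_t)$ Brownian motion. Solutions are strong solutions with continuous paths. *)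

(* Defs.v *)
From HB Require Import structures.
From mathcomp Require Import all_boot all_order all_algebra.
From mathcomp Require Import all_classical all_reals all_analysis.
Set Implicit Arguments.
Unset Strict Implicit.
Unset Printing Implicit Defensive.
Import Order.TTheory GRing.Theory Num.Theory.
Import numFieldNormedType.Exports.
Local Open Scope classical_set_scope.
Local Open Scope ring_scope.

(* Processes are maps R -> T -> _, used only at times t >= 0; likewise a
   filtration F : R -> set (set T) matters only on [0, +oo[. *)

Definition expmx (R : realType) (d : nat) (A : 'M[R]_d) : 'M[R]_d :=
  limn (series (fun k => k`!%:R^-1 *: A ^+ k)).

(* componentwise Lebesgue integral over [0, t] *)
Definition time_integral (R : realType) (d : nat) (f : R -> 'cV[R]_d) (t : R) :
    'cV[R]_d :=
  \col_i Rintegral lebesgue_measure `[0, t] (fun s => f s i 0).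

Section Filtrations.
Context (R : realType) (dT : measure_display) (T : measurableType dT).
Context (P : probability T R).

Definition sigma_mx (m n : nat) (Y : T -> 'M[R]_(m, n)) : set (set T) :=
  <<s \bigcup_(ij in [set: 'I_m * 'I_n])
        preimage_set_system setT (fun w => Y w ij.1 ij.2) measurable >>.

Definition filtration (F : R -> set (set T)) : Prop :=
  [/\ forall t, 0 <= t -> sigma_algebra setT (F t),
      forall t, 0 <= t -> F t `<=` measurable
    & forall s t, 0 <= s -> s <= t -> F s `<=` F t].

Definition usual_conditions (F : R -> set (set T)) : Prop :=
  [/\ filtration F,
      P.-negligible `<=` F 0
    & forall t, 0 <= t -> F t = \bigcap_(s in [set s | t < s]) F s].

Definition adapted (d : nat) (F : R -> set (set T)) (Y : R -> T -> 'cV[R]_d) :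
    Prop :=
  forall t, 0 <= t -> sigma_mx (Y t) `<=` F t.

Definition brownian_motion (d : nat) (F : R -> set (set T))
    (B : R -> T -> 'cV[R]_d) : Prop :=
  [/\ adapted F B,
      {ae P, forall w, B 0 w = 0},
      {ae P, forall w, {within `[0, +oo[, continuous (fun t => B t w)}},
      (* B t - B s has law N(0, (t - s) Id) *)
      forall s t, 0 <= s -> s < t -> forall U : 'I_d -> set R,
        (forall i, measurable (U i)) ->
        P [set w | forall i, U i ((B t w - B s w) i 0)] =
        (\prod_(i < d) normal_prob 0 (Num.sqrt (t - s)) (U i))%E
    & (* B t - B s is independent of F s *)
      forall s t, 0 <= s -> s < t -> forall A E, F s A ->
        sigma_mx (fun w => B t w - B s w) E ->
        P (A `&` E) = (P A * P E)%E].

(* P-augmentation of the filtration generated by B *)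
Definition augmented_natural_filtration (d : nat) (B : R -> T -> 'cV[R]_d)
    (t : R) : set (set T) :=
  <<s (\bigcup_(s in `[0, t]) sigma_mx (B s)) `|` P.-negligible >>.

(* I is the Ito integral of the simple process H against B:
   for H = xi_k on ]tau_k, tau_(k+1)], with xi_k bounded and
   F (tau_k)-measurable,
   I_t = \sum_k xi_k (B_(t /\ tau_(k+1)) - B_(t /\ tau_k)).
   The terms with tau_k >= t vanish, so the sum stops at any n with
   t <= tau_n. A time-independent deterministic H is such a process. *)
Definition simple_ito_integral (m d : nat) (F : R -> set (set T))
    (B : R -> T -> 'cV[R]_d) (H : R -> T -> 'M[R]_(m, d))
    (I : R -> T -> 'cV[R]_m) : Prop :=
  exists (tau : nat -> R) (xi : nat -> T -> 'M[R]_(m, d)),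
    [/\ [/\ tau 0%N = 0, forall k, tau k < tau k.+1 & tau @ \oo --> +oo],
        forall k, sigma_mx (xi k) `<=` F (tau k),
        exists M : R, forall k w, `|xi k w| <= M,
        forall k t w, tau k < t -> t <= tau k.+1 -> H t w = xi k w
      & forall n t w, 0 <= t -> t <= tau n ->
        I t w = \sum_(k < n)
          xi k w *m (B (Num.min t (tau k.+1)) w - B (Num.min t (tau k)) w)].

(* dX_t = sigma dB_t + b(X_t) dt, X_0 = x *)
Definition strong_solution (d : nat) (F : R -> set (set T))
    (B : R -> T -> 'cV[R]_d) (sigma : 'M[R]_d) (b : 'cV[R]_d -> 'cV[R]_d)
    (x : 'cV[R]_d) (X : R -> T -> 'cV[R]_d) : Prop :=
  [/\ adapted (augmented_natural_filtration B) X,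
      forall w, {within `[0, +oo[, continuous (fun t => X t w)},
      {ae P, forall w, X 0 w = x},
      {ae P, forall w, forall t i, 0 <= t ->
        lebesgue_measure.-integrable `[0, t] (fun s => (b (X s w) i 0)%:E)}
    & exists2 I, simple_ito_integral F B (fun _ _ => sigma) I &
      {ae P, forall w, forall t, 0 <= t ->
        X t w = X 0 w + I t w + time_integral (fun s => b (X s w)) t}].

End Filtrations.

(* Main.v *)
(* The function t |-> e^{tC} x solves y' = C y with y(0) = x, so that
   e^{tC} x = x + int_0^t C e^{sC} x ds (termwise differentiation of the entries
   of the exponential series, then the fundamental theorem of calculus). Adding
   this to the integral equation of X(., 0) pathwise yields the claim, the null
   set being that of X(., 0). For the constant integrand sigma, every version of
   the Ito integral is sigma (B_t - B_0), so it does not depend on the partition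
   that witnesses simplicity. *)
Require Import Defs.
From HB Require Import structures.
From mathcomp Require Import all_boot all_order all_algebra.
From mathcomp Require Import all_classical all_reals all_analysis.
From mathcomp Require Import ring.
Import Order.TTheory GRing.Theory Num.Theory.
Import numFieldNormedType.Exports.
Local Open Scope classical_set_scope.
Local Open Scope ring_scope.

(** * Entrywise limits and continuity of matrix products *)

Lemma cvg_mx_coord (R : realType) (U : Type) (G : set_system U)
    {FG : Filter G} (m n : nat)
    (f : U -> 'M[R]_(m, n)) (M : 'M[R]_(m, n)) :
  (forall i j, f u i j @[u --> G] --> M i j) -> f u @[u --> G] --> M.
Proof.
move=> fM; apply/cvgrPdist_le => e e0; near=> u.
rewrite /Num.Def.normr/= mx_normrE (bigmax_le _ (ltW e0))//= => i _.
(* The norm is the largest absolute entry; having finitely many entries, the eventual bounds on each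
   can be intersected. *)
rewrite !mxE/=; move: i; near: u; apply: filter_forall => /= i.
exact: ((cvgrPdist_le _ _).1 (fM i.1 i.2)).
Unshelve. all: by end_near. Qed.

Lemma mulmx_continuous (R : realType) (m n p : nat) (A : 'M[R]_(m, n)) :
  continuous (fun M : 'M[R]_(n, p) => A *m M).
Proof.
move=> M; apply: (@cvg_mx_coord _ _ (nbhs M)) => i j.
under eq_fun do rewrite mxE.
rewrite mxE; apply: cvg_big => [|k _]; first exact: add_continuous.
apply: cvgM; first exact: cvg_cst.
exact: coord_continuous.
Qed.

Lemma mulmx_continuousr (R : realType) (m n p : nat) (A : 'M[R]_(n, p)) :
  continuous (fun M : 'M[R]_(m, n) => M *m A).
Proof.
move=> M; apply: (@cvg_mx_coord _ _ (nbhs M)) => i j.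
under eq_fun do rewrite mxE.
rewrite mxE; apply: cvg_big => [|k _]; first exact: add_continuous.
apply: cvgM; last exact: cvg_cst.
exact: coord_continuous.
Qed.

(** * The matrix exponential as a family of scalar power series *)

Section MatrixExponential.
Variables (R : realType) (d : nat) (C : 'M[R]_d).

(** [A] is the sum of the absolute values of all entries of [C]. It dominates every row sum, so each
    further factor [C] costs at most a factor [A]. *)
Lemma coord_expr_le : exists2 A : R, 0 <= A &
  forall k i j, `|(C ^+ k) i j| <= A ^+ k.
Proof.
exists (\sum_i \sum_j `|C i j|); first by do 2!apply: sumr_ge0 => ? _.
elim=> [|k IHk] i j.
  by rewrite expr0 mxE; case: eqP => _; rewrite ?normr1 ?normr0.
rewrite exprS mxE (le_trans (ler_norm_sum _ _ _))// exprS.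
apply: (@le_trans _ _ (\sum_l `|C i l| * (\sum_i \sum_j `|C i j|) ^+ k)).
  by apply: ler_sum => l _; rewrite normrM ler_wpM2l.
rewrite -mulr_suml ler_wpM2r ?exprn_ge0//.
  by do 2!apply: sumr_ge0 => ? _.
rewrite [leRHS](bigD1 i)//= lerDl.
by do 2!apply: sumr_ge0 => ? _.
Qed.

(* coefficients of the p-th derivative of t |-> expmx (t *: C) i j *)
Definition expmx_coef p i j k : R := k`!%:R^-1 * (C ^+ (k + p)) i j.

(** Comparison with [A ^+ p] times the scalar exponential series at [A * |t|]; the radius of
    convergence is therefore infinite for every [p]. *)
Lemma is_cvg_pseries_expmx_coef p i j t : cvgn (pseries (expmx_coef p i j) t).
Proof.
have [A A0 leA] := coord_expr_le.
apply: normed_cvg; rewrite /normed_series_of /=.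
apply: (@series_le_cvg _ _
  (fun k => A ^+ p * exp_coeff (A * `|t|) k)) => [k|k|k|].
- exact: normr_ge0.
- by rewrite /exp_coeff/= mulr_ge0 ?exprn_ge0// divr_ge0 ?exprn_ge0 ?mulr_ge0.
- rewrite /exp_coeff/= /expmx_coef !normrM normrX normfV normr_nat.
  rewrite -mulrA [leRHS](_ : _ = k`!%:R^-1 * (A ^+ (k + p) * `|t| ^+ k)).
    by rewrite ler_wpM2l ?invr_ge0// ler_wpM2r ?exprn_ge0.
  by rewrite exprMn exprD; ring.
- exact/is_cvg_seriesZ/is_cvg_series_exp_coeff.
Qed.

(** Since (k+1)/(k+1)! = 1/k!, differentiation only raises the power of [C]. Derived series stay in
    the same family, so their convergence is already known. *)
Lemma pseries_diffs_expmx_coef p i j :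
  pseries_diffs (expmx_coef p i j) = expmx_coef p.+1 i j.
Proof.
apply/funext => k; rewrite /pseries_diffs /expmx_coef factS natrM invfM.
by rewrite addSnnS !mulrA divff ?mul1r// pnatr_eq0.
Qed.

Lemma exprmxZ (t : R) k : (t *: C) ^+ k = t ^+ k *: C ^+ k.
Proof.
elim: k => [|k IHk]; first by rewrite !expr0 scale1r.
by rewrite !exprS IHk -!mulmxE -scalemxAl -scalemxAr scalerA.
Qed.

Lemma expmxE t :
  expmx (t *: C) = \matrix_(i, j) limn (pseries (expmx_coef 0 i j) t).
Proof.
apply/cvg_lim; first exact: norm_hausdorff.
apply: cvg_mx_coord => i j; rewrite mxE.
rewrite (_ : (fun _ => _) = pseries (expmx_coef 0 i j) t).
  exact: is_cvg_pseries_expmx_coef.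
apply/funext => n; rewrite /pseries /series/= summxE; apply: eq_bigr => k _.
by rewrite exprmxZ !mxE /expmx_coef addn0 -mulrA [_ * t ^+ k]mulrC.
Qed.

Lemma expmx0 : expmx (0 *: C) = 1%:M.
Proof.
rewrite /expmx scale0r; apply/cvg_lim; first exact: norm_hausdorff.
apply: (@cvg_near_cst); near=> n.
(* The empty partial sum is 0; from n = 1 on, only the term k = 0 contributes and the partial sums
   are constant. *)
rewrite -(prednK (n := n)); last by near: n; exists 1%N.
rewrite /series/= big_nat_recl//= fact0 invr1 scale1r expr0 big1_seq ?addr0//.
by move=> k _; rewrite expr0n/= scaler0.
Unshelve. all: by end_near. Qed.

(** Termwise differentiation gives the series with coefficients from [C ^+ k.+1]; splitting off one
    factor [C] on the left leaves a finite combination of the series of the exponential. *)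
Lemma is_derive_expmx t i j :
  is_derive t (1 : R) (fun s : R => expmx (s *: C) i j)
    ((C *m expmx (t *: C)) i j).
Proof.
rewrite (_ : (fun s : R => _) =
  (fun s => limn (pseries (expmx_coef 0 i j) s))); last first.
  by apply/funext => s; rewrite expmxE mxE.
suff -> : (C *m expmx (t *: C)) i j =
    limn (pseries (pseries_diffs (expmx_coef 0 i j)) t).
  (* Termwise differentiation at [t] needs convergence at a point of larger modulus; any would do
     here. *)
  apply: (@pseries_snd_diffs _ _ (`|t| + 1));
    rewrite ?pseries_diffs_expmx_coef; try exact: is_cvg_pseries_expmx_coef.
  by rewrite [ltRHS]ger0_norm// ltrDl.
rewrite pseries_diffs_expmx_coef expmxE mxE.
apply/esym/cvg_lim; first exact: norm_hausdorff.
under eq_bigr do rewrite mxE.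
rewrite (_ : pseries _ _ =
  (fun n => \sum_l C i l * pseries (expmx_coef 0 l j) t n)).
  apply: cvg_big => [|l _]; [exact: add_continuous|apply: cvgMl_tmp].
  exact: is_cvg_pseries_expmx_coef.
apply/funext => n; rewrite /pseries /series/=.
under [RHS]eq_bigr do rewrite mulr_sumr.
rewrite exchange_big/=; apply: eq_bigr => k _.
rewrite /expmx_coef addn1 addn0 exprS mxE mulr_sumr mulr_suml.
apply: eq_bigr => l _.
by rewrite !mulrA [C i l * _]mulrC.
Qed.

End MatrixExponential.

(** * Componentwise time integrals of continuous paths *)

Section TimeIntegral.
Variables (R : realType) (d : nat).
Implicit Types f g : R -> 'cV[R]_d.

Lemma continuous_coord_integrable f t i :
  {within `[0, +oo[, continuous f} ->
  lebesgue_measure.-integrable `[0, t] (fun s => (f s i 0)%:E).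
Proof.
move=> cf.
apply: (@continuous_compact_integrable _ (fun s => f s i 0)).
  exact: segment_compact.
apply: (@continuous_subspaceW _ _ `[0, t] `[0, +oo[).
  by move=> s/=; rewrite !in_itv/= andbT => /andP[].
move=> s.
apply: (@continuous_comp (subspace _) _ _ f (fun v : 'cV[R]_d => v i 0)).
  exact: cf.
exact: coord_continuous.
Qed.

Lemma time_integralD f g t :
  {within `[0, +oo[, continuous f} -> {within `[0, +oo[, continuous g} ->
  time_integral (fun s => f s + g s) t = time_integral f t + time_integral g t.
Proof.
move=> cf cg; apply/colP => i; rewrite !mxE.
under eq_Rintegral do rewrite mxE.
by rewrite RintegralD//; exact: continuous_coord_integrable.
Qed.

Lemma time_integral_cst (a : 'cV[R]_d) t :
  0 <= t -> time_integral (fun=> a) t = t *: a.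
Proof.
move=> t0; apply/colP => i; rewrite !mxE Rintegral_cst//=.
rewrite lebesgue_measure_itv/= lte_fin; case: ltgtP t0 => // [? _|<- _];
  by rewrite ?oppr0 ?adde0 ?subr0 mulrC.
Qed.

Lemma within_continuousD (A : set R) f g :
  {within A, continuous f} -> {within A, continuous g} ->
  {within A, continuous (fun s => f s + g s)}.
Proof. by move=> cf cg s; apply: cvgD; [exact: cf|exact: cg]. Qed.

Lemma within_continuous_mulmx (A : set R) (M : 'M[R]_d) f :
  {within A, continuous f} -> {within A, continuous (fun s => M *m f s)}.
Proof.
move=> cf s; apply: (@continuous_comp (subspace _) _ _ f (mulmx M)).
  exact: cf.
exact: mulmx_continuous.
Qed.

Lemma continuous_expmx (C : 'M[R]_d) : continuous (fun t : R => expmx (t *: C)).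
Proof.
move=> t; apply: (@cvg_mx_coord _ _ (nbhs t)) => i j.
apply: differentiable_continuous; apply/derivable1_diffP.
by have [] := @is_derive_expmx _ _ C t i j.
Qed.

Lemma continuous_expmx_mulmx (C : 'M[R]_d) (x : 'cV[R]_d) :
  continuous (fun t : R => expmx (t *: C) *m x).
Proof.
move=> t.
apply: (@continuous_comp _ _ _ (fun s : R => expmx (s *: C)) (mulmxr x)).
  exact: continuous_expmx.
exact: mulmx_continuousr.
Qed.

Lemma is_derive_expmx_mulmx (C : 'M[R]_d) (x : 'cV[R]_d) t i :
  is_derive t (1 : R) (fun s : R => (expmx (s *: C) *m x) i 0)
    ((C *m (expmx (t *: C) *m x)) i 0).
Proof.
rewrite mulmxA mxE (_ : (fun s : R => _) =
  \sum_j (x j 0 \*: (fun s : R => expmx (s *: C) i j))).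
  under [X in is_derive _ _ _ X]eq_bigr do rewrite mulrC.
  by apply: is_derive_sum => j; apply/is_deriveZ/is_derive_expmx.
apply/funext => s; rewrite mxE fct_sumE; apply: eq_bigr => j _.
exact: mulrC.
Qed.

Lemma time_integral_expmx (C : 'M[R]_d) (x : 'cV[R]_d) t : 0 <= t ->
  time_integral (fun s => C *m (expmx (s *: C) *m x)) t =
  expmx (t *: C) *m x - x.
Proof.
rewrite le_eqVlt => /predU1P[<-|t0].
  (* The fundamental theorem of calculus is applied on a nondegenerate interval, so t = 0 is treated
     apart. *)
  rewrite expmx0 mul1mx subrr; apply/colP => i.
  by rewrite !mxE set_itv1 Rintegral_set1.
apply/colP => i; rewrite mxE /Rintegral.
have cF (F : R -> 'cV[R]_d) :
    continuous F -> continuous (fun s => F s i 0).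
  move=> cF s; apply: (@continuous_comp _ _ _ F (fun v : 'cV[R]_d => v i 0)).
    exact: cF.
  exact: coord_continuous.
have cE := cF _ (@continuous_expmx_mulmx C x).
rewrite (@continuous_FTC2 _ _ (fun s => (expmx (s *: C) *m x) i 0))//=.
- by rewrite expmx0 mul1mx !mxE.
- apply: continuous_subspaceT; apply: cF => s.
  apply: (@continuous_comp _ _ _ (fun s : R => expmx (s *: C) *m x) (mulmx C)).
    exact: continuous_expmx_mulmx.
  exact: mulmx_continuous.
- split=> [s _||].
  + by have [] := is_derive_expmx_mulmx C x s i.
  + by apply: cvg_at_right_filter; exact: cE.
  + by apply: cvg_at_left_filter; exact: cE.
- move=> s _; rewrite derive1E.
  by have [] := is_derive_expmx_mulmx C x s i.
Qed.

End TimeIntegral.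

(** All weights equal [sigma], so the defining sum telescopes. The identity holds for every [w],
    without a null set. *)
Lemma simple_ito_integral_cst {R : realType} {dT : measure_display}
    {T : measurableType dT} {F : R -> set (set T)} {m d : nat}
    {B : R -> T -> 'cV[R]_d} {sigma : 'M[R]_(m, d)} {I : R -> T -> 'cV[R]_m} :
  simple_ito_integral F B (fun _ _ => sigma) I ->
  forall t w, 0 <= t -> I t w = sigma *m (B t w - B 0 w).
Proof.
move=> [tau [xi [[tau0 tauS tauoo] _ _ xiE IE]]] t w t0.
(* The right endpoint belongs to the half-open interval of index [k], so the integrand can be read
   off there. *)
have {}xiE k : xi k w = sigma by rewrite -(xiE k (tau k.+1)).
have [n tn] : exists n, t <= tau n.
  have /cvgryPge/(_ t) [n _ /(_ n)/= tn] := tauoo.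
  by exists n; exact: tn.
rewrite (IE n)//; under eq_bigr do rewrite xiE.
rewrite -mulmx_sumr; congr (_ *m _).
rewrite -(big_mkord xpredT (fun k =>
  B (Num.min t (tau k.+1)) w - B (Num.min t (tau k)) w)).
rewrite (telescope_sumr (fun k => B (Num.min t (tau k)) w))//.
by rewrite tau0 (min_l tn) (min_r t0).
Qed.

(** Translates of Borel sets are Borel. This gives adaptedness of the shifted process, whose shift
    is deterministic at each time. *)
Lemma sigma_mx_addr (R : realType) (dT : measure_display)
    (T : measurableType dT) (m n : nat) (Y : T -> 'M[R]_(m, n))
    (c : 'M[R]_(m, n)) :
  sigma_mx (fun w => Y w + c) `<=` sigma_mx Y.
Proof.
apply: smallest_sub; first exact: smallest_sigma_algebra.
move=> A [ij _ [U mU <-]]; apply: sub_gen_smallest; exists ij => //.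
exists ((fun r => r + c ij.1 ij.2) @^-1` U).
  rewrite -[X in measurable X]setTI.
  by apply: (measurable_realfun.measurable_funD (@measurable_id _ _ _)
    (measurable_cst _)).
by rewrite !setTI; apply/seteqP; split => w /=; rewrite mxE.
Qed.

(** * The integral equation with affine drift, one path at a time *)

Section AffineDrift.
Variables (R : realType) (d : nat) (C : 'M[R]_d) (alpha : 'cV[R]_d).
Implicit Types Y J : R -> 'cV[R]_d.

Lemma time_integral_affine Y t : {within `[0, +oo[, continuous Y} -> 0 <= t ->
  time_integral (fun s => alpha + C *m Y s) t =
  t *: alpha + time_integral (fun s => C *m Y s) t.
Proof.
move=> cY t0; rewrite time_integralD ?time_integral_cst//.
  by move=> s; exact: cvg_cst.
exact: within_continuous_mulmx.
Qed.

Lemma within_continuous_shift Y (x : 'cV[R]_d) :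
  {within `[0, +oo[, continuous Y} ->
  {within `[0, +oo[, continuous (fun t => Y t + expmx (t *: C) *m x)}.
Proof.
move=> cY; apply: within_continuousD => //.
by apply: continuous_subspaceT; exact: continuous_expmx_mulmx.
Qed.

Lemma integral_equation_shift Y J (x : 'cV[R]_d) t :
  {within `[0, +oo[, continuous Y} -> 0 <= t ->
  Y t = J t + time_integral (fun s => alpha + C *m Y s) t ->
  Y t + expmx (t *: C) *m x =
  x + J t + t *: alpha
    + time_integral (fun s => C *m (Y s + expmx (s *: C) *m x)) t.
Proof.
move=> cY t0 ->; rewrite time_integral_affine//.
under [in RHS]eq_fun do rewrite mulmxDr.
rewrite time_integralD ?time_integral_expmx//; last 2 first.
- exact: within_continuous_mulmx.
- apply: within_continuous_mulmx; apply: continuous_subspaceT.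
  exact: continuous_expmx_mulmx.
(* Made opaque, both vectors survive the passage to coordinates as atoms for [ring]. *)
move: (time_integral _ _) (expmx _ *m x) => u v.
by apply/colP => i; rewrite !mxE; ring.
Qed.

End AffineDrift.

Theorem lemma3p1 (R : realType) (dT : measure_display) (T : measurableType dT)
    (P : probability T R) (F : R -> set (set T)) (d : nat)
    (B : R -> T -> 'cV[R]_d) (sigma C : 'M[R]_d) (alpha : 'cV[R]_d)
    (X : R -> T -> 'cV[R]_d) :
  measure_is_complete P ->
  usual_conditions P F ->
  brownian_motion P F B ->
  strong_solution P F B sigma (fun y => alpha + C *m y) 0 X ->
  (forall I : R -> T -> 'cV[R]_d,
     simple_ito_integral F B (fun _ _ => sigma) I ->
     {ae P, forall w, forall (t : R) (x : 'cV[R]_d), 0 <= t ->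
        X t w + expmx (t *: C) *m x =
        x + I t w + t *: alpha
          + time_integral (fun s => C *m (X s w + expmx (s *: C) *m x)) t}) /\
  (forall x : 'cV[R]_d,
     strong_solution P F B sigma (fun y => alpha + C *m y) x
       (fun t w => X t w + expmx (t *: C) *m x)).
Proof.
move=> _ _ _ [adX cX X0 _ [J JB XE]].
have XJ : {ae P, forall w, forall (t : R) (x : 'cV[R]_d), 0 <= t ->
    X t w + expmx (t *: C) *m x =
    x + J t w + t *: alpha
      + time_integral (fun s => C *m (X s w + expmx (s *: C) *m x)) t}.
  (* The exceptional set is fixed before [t] and [x] are introduced; the rest is deterministic, so
     one null set serves all of them. *)
  apply: filterS2 X0 XE => w X0 XE t x t0.
  apply: (@integral_equation_shift _ _ _ _ (X ^~ w) (J ^~ w)) => //.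
  by rewrite XE// X0 add0r.
split=> [I IB|x].
  apply: filterS XJ => w XJ t x t0; rewrite XJ//.
  (* [I] and [J] have the same closed form for all [w] and [t >= 0], so replacing one by the other
     costs no null set. *)
  by rewrite (simple_ito_integral_cst JB)// (simple_ito_integral_cst IB).
split.
- move=> t t0; apply: subset_trans (adX t t0); exact: sigma_mx_addr.
- by move=> w; exact: within_continuous_shift.
- by apply: filterS X0 => w ->; rewrite add0r expmx0 mul1mx.
(* Every path is continuous, hence the drift is integrable along every path. *)
- apply: aeW => w t i _.
  apply: (@continuous_coord_integrable _ _
    (fun s => alpha + C *m (X s w + expmx (s *: C) *m x))).
  apply: within_continuousD; first by move=> s; exact: cvg_cst.
  by apply: within_continuous_mulmx; exact: within_continuous_shift.
(* The noise is unchanged by the shift, so the same [J] is the witness. *)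
exists J => //; apply: filterS2 X0 XJ => w X0 XJ t t0.
rewrite time_integral_affine//; last exact: within_continuous_shift.
by rewrite XJ// X0 add0r expmx0 mul1mx addrA.
Qed.
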